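(* Let $n\ge 1$ and let $X_1,\dots,X_n$ be non-empty sets. The following are equivalent for a set $S\subset X_1\times X_2\times\cdots\times X_n$: (i) $S$ is good; (ii) $S$ is sequentially good; (iii) every finite subset of $S$ is good; (iv) $S$ is sequentially good for some algebra of complex-valued functions on $S$ which is closed under complex conjugation, separates points of $S$ and contains the constants.
   Context: Functions are complex valued. A set $S\subset X_1\times\cdots\times X_n$ is good if every function $f:S\to\mathbb{C}$ can be written as $f(x_1,\dots,x_n)=u_1(x_1)+\cdots+u_n(x_n)$ for all $(x_1,\dots,x_n)\in S$, for some functions $u_i:X_i\to\mathbb{C}$. $S$ is sequentially good for a function $f:S\to\mathbb{C}$ if there are functions $u_{i,k}:X_i\to\mathbb{C}$ ($1\le i\le n$, $k=1,2,3,\dots$) such that $f(x_1,\dots,x_n)=\lim_{k\to\infty}\bigl(u_{1,k}(x_1)+u_{2,k}(x_2)+\cdots+u_{n,k}(x_n)\bigr)$ for every $(x_1,\dots,x_n)\in S$ (pointwise limit). $S$ is sequentially good for a collection $\mathcal{F}$ of functions on $S$ if it is sequentially good for every $f\in\mathcal{F}$, and $S$ is sequentially good if it is sequentially good for every function $f:S\to\mathbb{C}$. An algebra of functions on $S$ is a complex linear subspace of the space of functions $S\to\mathbb{C}$ closed under pointwise multiplication. *)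

(* Defs.v *)
From mathcomp Require Import all_boot all_order all_algebra.
From mathcomp Require Import all_classical all_reals all_analysis.
From mathcomp Require Export complex.

Set Implicit Arguments.
Unset Strict Implicit.
Unset Printing Implicit Defensive.

Import Order.TTheory GRing.Theory Num.Theory.
Import numFieldNormedType.Exports.

Local Open Scope classical_set_scope.
Local Open Scope ring_scope.

(* The regular algebra R[i]^o rather than R[i]: it carries the topology of the
   complex modulus, and functions into it form a module over R[i], whereas
   R[i] itself is declared as a module over R. *)
Notation Cplx R := (R[i]^o).

Section Good.
Context {R : realType} {n : nat} {X : 'I_n -> Type}.
Implicit Types S : set (forall i, X i).

Definition good S : Prop :=
  forall f : S -> Cplx R, exists u : forall i, X i -> Cplx R,
    forall x : S, f x = \sum_(i < n) u i (val x i).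

Definition seq_good_for S (f : S -> Cplx R) : Prop :=
  exists u : forall i, nat -> X i -> Cplx R,
    forall x : S, (fun k => \sum_(i < n) u i k (val x i)) @ \oo --> f x.

Definition seq_good_for_set S (F : set (S -> Cplx R)) : Prop :=
  forall f, F f -> seq_good_for f.

Definition seq_good S : Prop := forall f : S -> Cplx R, seq_good_for f.

End Good.

Arguments good R {n X} S.
Arguments seq_good R {n X} S.

Section FunctionAlgebra.
Context {R : realType} {T : Type}.
Implicit Types A : set (T -> Cplx R).

(* Not required to contain the constant function 1. *)
Definition function_algebra A : Prop :=
  GRing.submod_closed (mem A) /\ GRing.mulr_2closed (mem A).

Definition conj_closed A : Prop :=
  forall f, A f -> A (fun x => Num.conj (f x : R[i])).

Definition separates_points A : Prop :=
  forall x y : T, x <> y -> exists2 f, A f & f x <> f y.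

Definition contains_constants A : Prop := forall c : Cplx R, A (cst c).

End FunctionAlgebra.

(* Main.v *)
(* (iv) gives (iii): by interpolation the algebra restricts to all functions on
   a finite F, and the sums u_1(x_1) + ... + u_n(x_n) restrict to a linear
   subspace of the functions on F, which is closed under limits because F is
   finite. (iii) gives (i): writing f as such a sum is a system of linear
   equations in the unknowns u_i(y), each involving finitely many of them, and
   such a system over a field is solvable as soon as its finite subsystems are.
   For the latter, a maximal finitely solvable system (Zorn) prescribes the
   value of every unknown. *)

Require Import Defs.
From mathcomp Require Import all_boot all_order all_algebra.
From mathcomp Require Import all_classical all_reals all_analysis.
From mathcomp Require Import ring.

Import GRing.Theory.
Import numFieldNormedType.Exports.

Local Open Scope classical_set_scope.
Local Open Scope ring_scope.

(** Each entry of [s] lies in some member of the chain, and the largest of these finitely many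
    members contains them all; [C !=set0] covers the empty list. *)
Lemma seq_sub_chain (T : eqType) (C : set (set T)) (s : seq T) :
  C !=set0 -> total_on C subset -> [set` s] `<=` \bigcup_(A in C) A ->
  exists2 A, C A & [set` s] `<=` A.
Proof.
move=> [A0 CA0] totC; elim: s => [|a s IH] sC; first by exists A0.
have [|A CA sA] := IH.
  by move=> x xs; apply: sC; rewrite /= in_cons xs orbT.
have [|B CB Ba] := sC a; first by rewrite /= mem_head.
have [AB|BA] := totC _ _ CA CB; [exists B|exists A] => // x /=;
  rewrite in_cons => /predU1P[->|/sA]; auto.
Qed.

(** * Compactness for systems of linear equations over a field *)

Section LinearSystems.
Context {K : fieldType} {Y : choiceType}.

Definition lin_eqn : choiceType := (seq (K * Y) * K)%type.
Implicit Types (e : lin_eqn) (s : seq lin_eqn) (Q : set lin_eqn) (u : Y -> K).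

Definition solves u e : Prop := \sum_(p <- e.1) p.1 * u p.2 = e.2.

Definition coord_eqn (y : Y) (v : K) : lin_eqn := ([:: (1, y)], v).

Definition finitely_solvable Q : Prop :=
  forall s, [set` s] `<=` Q -> exists u, forall e, e \in s -> solves u e.

Lemma solves_coord u y v : solves u (coord_eqn y v) <-> u y = v.
Proof. by rewrite /solves big_seq1 mul1r. Qed.

Lemma solves_line u w t e :
  solves u e -> solves w e -> solves (fun y => u y + t * (w y - u y)) e.
Proof.
rewrite /solves => ue we.
under eq_bigr => p _ do rewrite mulrDr mulrCA mulrBr.
by rewrite big_split /= -mulr_sumr sumrB ue we subrr mulr0 addr0.
Qed.

(* The values at y of the solutions of a finite subsystem form an affine
   subspace of K, so either one subsystem forces that value or 0 is allowed
   by all of them. *)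
Lemma finitely_solvable_coord Q (y : Y) : finitely_solvable Q ->
  exists v, finitely_solvable (Q `|` [set coord_eqn y v]).
Proof.
move=> fsQ.
have subQ v s : [set` s] `<=` Q `|` [set coord_eqn y v] ->
    [set` [seq e <- s | e != coord_eqn y v]] `<=` Q.
  move=> sQ e /=; rewrite mem_filter => /andP[/eqP ne es].
  by have [] := sQ e es.
have extend v s u :
    (forall e, e \in [seq e <- s | e != coord_eqn y v] -> solves u e) ->
    u y = v -> forall e, e \in s -> solves u e.
  move=> us uy e es; have [->|ne] := eqVneq e (coord_eqn y v).
    exact/solves_coord.
  by apply: us; rewrite mem_filter ne.
have [[s0 s0Q [v forced]]|nforced] := pselect
    (exists2 s0 : seq lin_eqn, [set` s0] `<=` Q &
     exists v, forall u, (forall e, e \in s0 -> solves u e) -> u y = v).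
  exists v => s /subQ sQ.
  (* Joining [s0] to the subsystem makes every common solution take the forced value at [y]. *)
  have [|u us] := fsQ (s0 ++ [seq e <- s | e != coord_eqn y v]).
    by move=> e /=; rewrite mem_cat => /orP[/s0Q|/sQ].
  exists u; apply: (extend v).
    by move=> e es; apply: us; rewrite mem_cat es orbT.
  by apply: forced => e es; apply: us; rewrite mem_cat es.
exists 0 => s /subQ sQ; have [u us] := fsQ _ sQ.
have [w ws wy] : exists2 w,
    (forall e, e \in [seq e <- s | e != coord_eqn y 0] -> solves w e) &
    w y != u y.
  apply: contrapT => nw; apply: nforced.
  exists [seq e <- s | e != coord_eqn y 0] => //.
  exists (u y) => w ws; apply: contrapT => /eqP wy; by apply: nw; exists w.
(* On the affine line through the solutions [u] and [w], this parameter gives the point whose value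
   at [y] is 0. *)
exists (fun z => u z + (u y / (u y - w y)) * (w z - u z)); apply: (extend 0).
  by move=> e es; apply: solves_line; [exact: us|exact: ws].
have : u y - w y != 0 by rewrite subr_eq0 eq_sym.
by move=> d0; field.
Qed.

Lemma finitely_solvable_solvable Q : finitely_solvable Q ->
  exists u, forall e, Q e -> solves u e.
Proof.
move=> fsQ.
have [|A [fsA maxA]] := @Zorn_bigcup lin_eqn
    [set A | finitely_solvable (Q `|` A)].
  (* The empty chain has empty union, which leaves [Q] itself. *)
  move=> C CP totC s sQC; have [C0|C0] := pselect (C !=set0); last first.
    apply: fsQ => e /sQC[//|[A CA]]; by case: C0; exists A.
  have [|||B [A CA <-] sA] := @seq_sub_chain _ [set Q `|` A | A in C] s.
  - by case: C0 => A CA; exists (Q `|` A), A.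
  - move=> _ _ [A CA <-] [B CB <-].
    by have [AB|BA] := totC _ _ CA CB; [left|right]; apply: setUS.
  - move=> e /sQC[Qe|[A CA Ae]].
      by case: C0 => A CA; exists (Q `|` A); [exists A|left].
    by exists (Q `|` A); [exists A|right].
  exact: (CP A CA).
have val y : exists v, A (coord_eqn y v).
  have [v fsv] := finitely_solvable_coord _ y fsA; exists v.
  apply: contrapT => nAv; apply: (maxA (A `|` [set coord_eqn y v])).
    split; first by move=> e Ae; left.
    by move=> /(_ (coord_eqn y v)) => h; apply: nAv; apply: h; right.
  by rewrite /= setUA.
have [u Au] := choice val; exists u => e Qe; rewrite /solves.
(* A solution [w] of [e] together with the coordinate equations of its unknowns agrees with [u] on
   those unknowns, so [u] solves [e] too. *)
have [|w ws] := fsA (e :: [seq coord_eqn p.2 (u p.2) | p <- e.1]).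
  move=> e' /=; rewrite in_cons => /predU1P[->|/mapP[p _ ->]]; first by left.
  by right; apply: Au.
have <- : \sum_(p <- e.1) p.1 * w p.2 = e.2 by apply: ws; rewrite mem_head.
apply: eq_big_seq => p pe; congr (_ * _); symmetry; apply/solves_coord.
by apply: ws; rewrite in_cons; apply/orP; right; apply/mapP; exists p.
Qed.

End LinearSystems.

(** * Limits in a linear space of functions, on finitely many points *)

Section FunctionSpaces.
Context {K : numFieldType} {T : eqType}.
Implicit Types (V : set (T -> K^o)) (s : seq T).

(** Elimination of one point of [s] at a time. The induction generalises over [V], which shrinks to
    a subspace at each step. *)
Lemma submod_finite_limit V {I : Type} (G : set_system I) {FG : ProperFilter G}
    (v : I -> T -> K^o) (f : T -> K^o) s :
  GRing.submod_closed (mem V) -> (forall k, V (v k)) ->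
  (forall x, x \in s -> v k x @[k --> G] --> f x) ->
  exists2 w, V w & {in s, w =1 f}.
Proof.
move=> [V0 Vlin]; move: V0; rewrite inE => V0.
have {}Vlin a u w : V u -> V w -> V (a *: u + w).
  by move=> Vu Vw; apply: set_mem; apply: Vlin; apply: mem_set.
elim: s V V0 Vlin v f => [|b s IH] V V0 Vlin v f Vv vf; first by exists 0.
have vfs x : x \in s -> v k x @[k --> G] --> f x.
  by move=> xs; apply: vf; rewrite in_cons xs orbT.
have vfb : v k b @[k --> G] --> f b by apply: vf; rewrite mem_head.
have [[w0 Vw0 w0b]|nw0] := pselect (exists2 w0, V w0 & w0 b != 0); last first.
  (* If all of [V] vanishes at [b], then [f b] is a limit of zeros and any [w] fits there. *)
  have zb w : V w -> w b = 0.
    by move=> Vw; apply: contrapT => /eqP wb; apply: nw0; exists w.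
  have [w Vw ws] := IH V V0 Vlin v f Vv vfs; exists w => // x.
  rewrite in_cons => /predU1P[->|/ws//]; rewrite zb//.
  move: vfb; rewrite (_ : (fun k => v k b) = cst 0).
    by apply: (cvg_unique (@norm_hausdorff _ K^o)); exact: cvg_cst.
  by apply/funext => k; exact: zb.
(* Subtracting multiples of w0 moves the sequence into the members of V that
   vanish at b. *)
pose red (g : T -> K^o) : T -> K^o := (- (g b / w0 b)) *: w0 + g.
have [||||w [Vw wb] ws] := IH [set w | V w /\ w b = 0] _ _ (red \o v) (red f).
- by split.
- move=> a u w [Vu ub] [Vw wb]; split; first exact: Vlin.
  by rewrite !fctE ub wb scaler0 addr0.
- move=> k; split; first exact: Vlin.
  by rewrite /red /= !fctE /GRing.scale /= mulNr divfK // addNr.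
- move=> x xs; rewrite /red /=; apply: cvgD; last exact: vfs.
  apply: cvgM; last exact: cvg_cst.
  by apply: cvgN; apply: cvgM => //; exact: cvg_cst.
(* This restores the multiple of [w0] that [red] removed from [f]. *)
exists ((f b / w0 b) *: w0 + w); first exact: Vlin.
move=> x; rewrite in_cons => /predU1P[->|xs].
  by rewrite !fctE wb addr0 /GRing.scale /= divfK.
by rewrite !fctE ws // /red !fctE scaleNr addrA subrr add0r.
Qed.

End FunctionSpaces.

(** * Interpolation in a separating algebra *)

Section Interpolation.
Context {R : realType} {T : eqType}.

Lemma algebra_interpolation (A : set (T -> Cplx R)) (f : T -> Cplx R)
    (s : seq T) :
  function_algebra A -> separates_points A -> contains_constants A ->
  exists2 g, A g & {in s, g =1 f}.
Proof.
move=> [[_ Alin] Amul] Asep Acst.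
have {}Alin a g h : A g -> A h -> A (a *: g + h).
  by move=> Ag Ah; apply: set_mem; apply: Alin; apply: mem_set.
have {}Amul g h : A g -> A h -> A (g * h).
  by move=> Ag Ah; apply: set_mem; apply: Amul; apply: mem_set.
have bump b (t : seq T) : b \notin t ->
    exists2 p, A p & p b = 1 /\ {in t, p =1 cst 0}.
  elim: t => [_|c t IH]; first by exists (cst 1).
  rewrite in_cons negb_or => /andP[bc /IH[p Ap [pb pt]]].
  have [h Ah hbc] := Asep b c (elimN eqP bc).
  have d0 : h b - h c != 0 by rewrite subr_eq0; exact/eqP.
  (* The new factor is (h - h c) / (h b - h c), equal to 1 at [b] and 0 at [c]. *)
  exists (((h b - h c)^-1 *: h + cst (- ((h b - h c)^-1 * h c))) * p).
    by apply: Amul => //; apply: Alin.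
  split=> [|x].
    by rewrite !fctE pb mulr1 -mulrBr mulVf.
  rewrite in_cons => /predU1P[->|xt]; first by rewrite !fctE subrr mul0r.
  by rewrite !fctE pt // mulr0.
elim: s => [|b s [g Ag gs]]; first by exists (cst 0).
have [bs|bs] := boolP (b \in s).
  by exists g => // x; rewrite in_cons => /predU1P[->|]; apply: gs.
(* As [p] vanishes on [s], a multiple of it corrects the value at [b] without disturbing the
   others. *)
have [p Ap [pb ps]] := bump b s bs.
exists ((f b - g b) *: p + g); first exact: Alin.
move=> x; rewrite in_cons => /predU1P[->|xs].
  by rewrite !fctE pb /GRing.scale /= mulr1 subrK.
by rewrite !fctE ps // scaler0 add0r gs.
Qed.

End Interpolation.

(** * Good sets and their finite subsets *)

Section Good.
Context {R : realType} {n : nat} {X : 'I_n -> Type}.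
Implicit Type S : set (forall i, X i).

(** Keeping [f] on all of [S] and matching it only on [D] avoids a change of domain for each finite
    subset; [finitely_goodP] links this form to (iii). *)
Definition finitely_good S : Prop :=
  forall (f : S -> Cplx R) (D : set S), finite_set D ->
    exists u : forall i, X i -> Cplx R,
      forall x : S, D x -> f x = \sum_(i < n) u i (val x i).

Lemma good_seq_good S : good R S -> seq_good R S.
Proof.
move=> gS f; have [u fu] := gS f; exists (fun i _ => u i) => x.
by rewrite -fu; exact: cvg_cst.
Qed.

Lemma seq_good_for_algebra_finitely_good S (A : set (S -> Cplx R)) :
  function_algebra A -> separates_points A -> contains_constants A ->
  seq_good_for_set A -> finitely_good S.
Proof.
move=> Aalg Asep Acst AS f _ /(@finite_seqP {classic S})[s ->].
(* Only members of the algebra are known to be limits of sums, so [f] is replaced by one that agrees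
   with it on [s]. *)
have [g Ag gf] := @algebra_interpolation R {classic S} A f s Aalg Asep Acst.
have [u ug] := AS g Ag.
pose V : set ({classic S} -> Cplx R) :=
  [set h | exists w : forall i, X i -> Cplx R,
     h = fun x : S => \sum_(i < n) w i (val x i)].
have [|||_ [w ->] ws] := @submod_finite_limit R[i] {classic S} V nat \oo _
    (fun k (x : S) => \sum_(i < n) u i k (val x i)) g s.
- split=> [|a h1 h2]; rewrite !inE.
    by exists (fun _ _ => 0); apply/funext => x; rewrite big1.
  move=> [w1 ->] [w2 ->]; exists (fun i y => a *: w1 i y + w2 i y).
  by apply/funext => x; rewrite !fctE /= big_split scaler_sumr.
- by move=> k; exists (fun i => u i k).
- by move=> x _; exact: ug.
by exists w => x xs; rewrite -gf // ws.
Qed.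

Lemma finitely_good_good S : finitely_good S -> good R S.
Proof.
move=> fgS f.
(* The tag [i] keeps unknowns of different coordinates apart. *)
pose Y : choiceType := {classic {i & X i}}.
pose pt (x : S) i : Y := existT X i (val x i).
pose eqn (x : S) : @lin_eqn R[i] Y := ([seq (1, pt x i) | i <- enum 'I_n], f x).
have sumE (u : Y -> R[i]) x : \sum_(p <- (eqn x).1) p.1 * u p.2 =
    \sum_(i < n) u (pt x i).
  by rewrite big_map big_enum; apply: eq_bigr => i _; rewrite mul1r.
have [|u su] := @finitely_solvable_solvable R[i] Y (range eqn).
  move=> s sS.
  (* The finite list of equations is lifted to a finite list of points, where [fgS] applies. *)
  have [t st] : exists t : seq {classic S},
      {in s, forall e, exists2 x, x \in t & e = eqn x}.
    elim: s sS => [|e s IH] sS; first by exists [::].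
    have [|x _ xe] := sS e; first by rewrite /= mem_head.
    have [|t ht] := IH.
      by move=> e' es; apply: sS; rewrite /= in_cons es orbT.
    exists (x :: t) => e'; rewrite in_cons => /predU1P[->|/ht[y yt ->]].
      by exists x; rewrite ?mem_head.
    by exists y; rewrite ?in_cons ?yt ?orbT.
  have [u fu] := fgS f _ (@finite_seq {classic S} t).
  exists (fun y : Y => u (tag y) (tagged y)) => e /st[x xt ->].
  by apply: (etrans (sumE _ x)); symmetry; exact: fu.
exists (fun i y => u (existT X i y)) => x.
by rewrite -sumE; symmetry; exact: (su (eqn x) (imageT eqn x)).
Qed.

Lemma finitely_goodP S : finitely_good S <->
  forall F : set (forall i, X i), F `<=` S -> finite_set F -> good R F.
Proof.
split=> [fgS F FS finF f|gF f D finD].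
  have inS (x : F) : val x \in S by apply/mem_set/FS/set_mem/valP.
  (* Extension of [f] by 0 outside [F]. *)
  pose g (x : S) : Cplx R :=
    if pselect (val x \in F) is left xF then f (exist _ (val x) xF) else 0.
  have [|u gu] := fgS g [set x : S | F (val x)].
    by apply: finite_preimage => // x y _ _; exact: val_inj.
  exists u => x; rewrite -(gu (exist _ (val x) (inS x))) /g /=; last first.
    exact/set_mem/valP.
  case: pselect => [xF|]; last by rewrite (valP x).
  by congr f; exact: val_inj.
pose F : set (forall i, X i) := [set val x | x in D].
have FS : F `<=` S by move=> _ [x _ <-]; exact/set_mem/valP.
have inS (x : F) : val x \in S by apply/mem_set/FS/set_mem/valP.
have [u fu] := gF F FS (finite_image val finD)
  (fun x => f (exist _ (val x) (inS x))).
exists u => x Dx; have xF : val x \in F by apply: mem_set; exists x.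
rewrite -(fu (exist _ (val x) xF)); congr f; exact: val_inj.
Qed.

End Good.

Arguments finitely_good R {n X} S.

Theorem theorem2p1 (R : realType) (n : nat) (X : 'I_n -> Type)
    (hn : (1 <= n)%N) (hX : forall i : 'I_n, inhabited (X i))
    (S : set (forall i : 'I_n, X i)) :
  [<-> good R S;
       seq_good R S;
       forall F : set (forall i : 'I_n, X i),
         F `<=` S -> finite_set F -> good R F;
       exists A : set (S -> Cplx R),
         [/\ function_algebra A, conj_closed A, separates_points A,
             contains_constants A & seq_good_for_set A]].
Proof.
have setT_alg : seq_good R S -> exists A : set (S -> Cplx R),
    [/\ function_algebra A, conj_closed A, separates_points A,
        contains_constants A & seq_good_for_set A].
  (* The algebra of all functions works; the indicator of [x] separates [x] from any other point. *)
  move=> sS; exists setT; split=> //.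
  - by split; [split=> [|a f g _ _]|move=> f g _ _]; exact: mem_set.
  - move=> x y xy; exists (fun z => (`[<z = x>])%:R) => //.
    rewrite asboolT // asboolF => [/eqP|yx]; first by rewrite oner_eq0.
    by apply: xy.
have alg_fin : (exists A : set (S -> Cplx R),
    [/\ function_algebra A, conj_closed A, separates_points A,
        contains_constants A & seq_good_for_set A]) -> finitely_good R S.
  case=> A [Aalg Aconj Asep Acst AS].
  exact: (@seq_good_for_algebra_finitely_good _ _ _ _ A).
(* The cycle is (i), (ii), (iii), (iv), (i): (ii) reaches (iii) through (iv), and (iii) reaches (iv)
   through (i) and (ii). *)
tfae.
- exact: good_seq_good.
- by move=> /setT_alg /alg_fin /finitely_goodP.
- by move=> /finitely_goodP /finitely_good_good /good_seq_good /setT_alg.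
- by move=> /alg_fin /finitely_good_good.
Qed.
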